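(* Let $A\in\mathbb{R}^{n\times n}$ be a nonsingular matrix. Then $\Psi_{k}(A)=\Psi_{k}(A^{T})$ for all $k=1,\dots,d(A)-1$.
   Context: $\|\cdot\|$ is the Euclidean norm, $d(A)$ denotes the degree of the minimal polynomial of $A$, and $\pi_k$ is the set of real polynomials $p$ of degree at most $k$ with $p(0)=1$. For a real square matrix $M\in\mathbb{R}^{n\times n}$, the $k$th worst-case GMRES approximation is $$\Psi_k(M)=\max_{v\in\mathbb{R}^n,\ \|v\|=1}\ \min_{p\in\pi_k}\|p(M)v\|.$$ *)

(* Defs.v *)
From HB Require Import structures.
From mathcomp Require Import all_boot all_order all_algebra.
From mathcomp Require Import all_classical all_reals all_analysis.

Set Implicit Arguments.
Unset Strict Implicit.
Unset Printing Implicit Defensive.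

Import Order.TTheory GRing.Theory Num.Theory.
Import numFieldNormedType.Exports.

Local Open Scope classical_set_scope.
Local Open Scope ring_scope.

(* MathComp-Analysis equips matrices with the max norm `|v|, hence this
   separate definition of the Euclidean norm. *)
Definition enorm (R : realType) (n : nat) (v : 'cV[R]_n) : R :=
  Num.sqrt (\sum_(i < n) v i ord0 ^+ 2).

(* The size of a polynomial is its degree plus one. *)
Definition minpoly_degree (R : realType) (n : nat) (A : 'M[R]_n.+1) : nat :=
  (size (mxminpoly A)).-1.

Definition residual_poly (R : realType) (k : nat) : set {poly R} :=
  [set p : {poly R} | (size p <= k.+1)%N /\ p.[0] = 1].

(* gmres_residual_min and worst_case_gmres_max below show that this inf is a
   minimum and that the sup in worst_case_gmres is a maximum. *)
Definition gmres_residual (R : realType) (n k : nat) (M : 'M[R]_n.+1)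
    (v : 'cV[R]_n.+1) : R :=
  inf [set enorm (horner_mx M p *m v) | p in residual_poly k].

Definition worst_case_gmres (R : realType) (n k : nat) (M : 'M[R]_n.+1) : R :=
  sup [set gmres_residual k M v | v in [set v : 'cV[R]_n.+1 | enorm v = 1]].

Section Attainment.
Variables (R : realType).

Lemma residual_poly1 k : residual_poly k (1 : {poly R}).
Proof. by split; [rewrite size_poly1|rewrite hornerC]. Qed.

Lemma enorm_ge0 n (v : 'cV[R]_n) : 0 <= enorm v.
Proof. exact: sqrtr_ge0. Qed.

Lemma trmx_mul_self n (v : 'cV[R]_n) :
  v^T *m v = (\sum_(i < n) v i ord0 ^+ 2)%:M.
Proof.
apply/matrixP => i j; rewrite !ord1 !mxE /= mulr1n.
by apply: eq_bigr => l _; rewrite mxE expr2.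
Qed.

Lemma trmx_mul_self_eq0 n (v : 'cV[R]_n) : v^T *m v = 0 -> v = 0.
Proof.
rewrite trmx_mul_self => /matrixP/(_ ord0 ord0).
rewrite !mxE /= mulr1n => /eqP.
rewrite psumr_eq0 => [/allP h|i _]; last exact: sqr_ge0.
apply/matrixP => i j; rewrite !ord1 mxE; apply/eqP.
by rewrite -sqrf_eq0; apply: h; rewrite mem_index_enum.
Qed.

(* Normal equations: the columns of B have a combination B *m c such that
   v + B *m c is orthogonal to all of them. *)
Lemma normal_equations n k (B : 'M[R]_(n, k)) (v : 'cV[R]_n) :
  exists c : 'cV[R]_k, B^T *m (v + B *m c) = 0.
Proof.
have sub : (B <= B^T *m B)%MS.
  rewrite submxE; apply/eqP; set Z := cokermx _.
  have BZ0 : B^T *m (B *m Z) = 0 by rewrite mulmxA mulmx_coker.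
  apply/matrixP => i j; rewrite [RHS]mxE.
  have -> : (B *m Z) i j = col j (B *m Z) i ord0 by rewrite [RHS]mxE.
  rewrite (_ : col j (B *m Z) = 0) ?mxE//; apply: trmx_mul_self_eq0.
  have ZZ0 : (B *m Z)^T *m (B *m Z) = 0 by rewrite trmx_mul -mulmxA BZ0 mulmx0.
  rewrite colE; move: (B *m Z) ZZ0 => Y YY0.
  by rewrite trmx_mul mulmxA -(mulmxA _ Y^T) YY0 mulmx0 mul0mx.
have /submxP[D hD] := submx_trans (submxMl v^T B) sub.
exists (- D^T); rewrite mulmxDr mulmxN mulmxN mulmxA.
have := congr1 trmx hD; rewrite !trmx_mul !trmxK => ->.
by rewrite subrr.
Qed.

Lemma enorm_le n (u w : 'cV[R]_n) : w^T *m u = 0 -> enorm u <= enorm (u + w).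
Proof.
move=> wu; rewrite ler_sqrt; last by apply: sumr_ge0 => i _; exact: sqr_ge0.
have uw : \sum_(i < n) w i ord0 * u i ord0 = 0.
  have /matrixP/(_ ord0 ord0) := wu; rewrite !mxE => e; rewrite -[RHS]e.
  by apply: eq_bigr => i _; rewrite mxE.
rewrite [leRHS](eq_bigr (fun i => u i ord0 ^+ 2 + w i ord0 ^+ 2 +
                           (w i ord0 * u i ord0) *+ 2)); last first.
  by move=> i _; rewrite mxE sqrrD addrAC mulrC.
rewrite big_split /= sumrMnl uw mul0rn addr0 big_split /= lerDl.
by apply: sumr_ge0 => i _; exact: sqr_ge0.
Qed.

Lemma gmres_residual_min n k (M : 'M[R]_n.+1) (v : 'cV[R]_n.+1) :
  exists2 p, residual_poly k p &
    enorm (horner_mx M p *m v) = gmres_residual k M v /\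
    forall q, residual_poly k q ->
      enorm (horner_mx M p *m v) <= enorm (horner_mx M q *m v).
Proof.
pose B : 'M[R]_(n.+1, k) := \matrix_(i, j) (M ^+ j.+1 *m v) i ord0.
have BE (c : 'cV[R]_k) :
    horner_mx M (\sum_(j < k) c j ord0 *: 'X^(j.+1)) *m v = B *m c.
  rewrite rmorph_sum /= mulmx_suml; apply/matrixP => i j.
  rewrite !ord1 summxE mxE; apply: eq_bigr => l _.
  by rewrite linearZ /= rmorphXn /= horner_mx_X -scalemxAl !mxE mulrC.
pose P (c : 'cV[R]_k) : {poly R} := 1 + \sum_(j < k) c j ord0 *: 'X^(j.+1).
have PE c : horner_mx M (P c) *m v = v + B *m c.
  by rewrite rmorphD rmorph1 mulmxDl BE mul1mx.
have Ppi c : residual_poly k (P c).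
  split.
    rewrite (leq_trans (size_polyD _ _))// geq_max size_poly1 /=.
    apply: (leq_trans (size_sum _ _ _)); apply/bigmax_leqP => j _.
    by rewrite (leq_trans (size_scale_leq _ _))// size_polyXn ltnS.
  rewrite /P hornerD hornerC horner_sum big1 ?addr0// => j _.
  by rewrite hornerZ hornerXn expr0n mulr0.
have piP q : residual_poly k q -> exists c, q = P c.
  move=> [sq q0]; exists (\col_j q`_j.+1).
  rewrite -[LHS](coefK q) (poly_def (size q)).
  have -> : \sum_(i < size q) q`_i *: 'X^i = \sum_(i < k.+1) q`_i *: 'X^i.
    rewrite (big_ord_widen _ (fun i => q`_i *: 'X^i) sq) [LHS]big_mkcond /=.
    by apply: eq_bigr => i _; case: ltnP => // h; rewrite nth_default ?scale0r.
  rewrite big_ord_recl /= -horner_coef0 q0 expr0 scale1r; congr (_ + _).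
  by apply: eq_bigr => j _; rewrite mxE.
have [c hc] := normal_equations B v.
have minP q : residual_poly k q ->
    enorm (horner_mx M (P c) *m v) <= enorm (horner_mx M q *m v).
  move=> /piP[d ->]; rewrite !PE.
  have -> : v + B *m d = (v + B *m c) + B *m (d - c).
    by rewrite mulmxBr -addrA [B *m c + _]addrC subrK.
  by apply: enorm_le; rewrite trmx_mul -mulmxA hc mulmx0.
exists (P c) => //; split=> //; apply/eqP; rewrite eq_le; apply/andP; split.
  apply: lb_le_inf; first by eexists; exists 1; [exact: residual_poly1|].
  by move=> _ [q qk <-]; exact: minP.
apply: ge_inf; last by exists (P c).
by exists 0 => _ [q _ <-]; exact: enorm_ge0.
Qed.

Lemma compact_sup_inf_attained (T : topologicalType) (J : Type) (D : set J)
    (g : J -> T -> R) (K : set T) :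
  compact K -> K !=set0 -> (forall j, continuous (g j)) ->
  (forall j x, 0 <= g j x) -> D !=set0 ->
  exists2 x, K x & forall y, K y ->
    inf [set g j y | j in D] <= inf [set g j x | j in D].
Proof.
move=> cK K0 gc g0 [j0 Dj0]; pose f x := inf [set g j x | j in D].
have flb x : has_lbound [set g j x | j in D].
  by exists 0 => _ [j _ <-]; exact: g0.
have fle j x : D j -> f x <= g j x by move=> Dj; apply: ge_inf => //; exists j.
have [[x Kx hx]|nomax] := pselect (exists2 x, K x & forall y, K y -> f y <= f x).
  by exists x.
exfalso.
have fK : has_sup (f @` K).
  split; first by case: K0 => x Kx; exists (f x); exists x.
  have /compact_bounded[M [_ hM]] : compact (g j0 @` K).
    apply: continuous_compact => //; apply: continuous_subspaceT; exact: gc.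
  exists (M + 1) => _ [x Kx <-].
  rewrite (le_trans (fle j0 x Dj0))// (le_trans (ler_norm _))//.
  by apply: (hM (M + 1)); [rewrite ltrDl|exists x].
set S := sup (f @` K).
have fS y : K y -> f y < S.
  move=> Ky; rewrite lt_neqAle; apply/andP; split; last first.
    by apply: sup_upper_bound => //; exists y.
  apply/eqP => fyS; apply: nomax; exists y => // z Kz; rewrite fyS.
  by apply: sup_upper_bound => //; exists z.
have /compact_near_coveringP/(_ R S^'- (fun s x => f x < s)) := cK.
have loc x : K x -> \forall x' \near x & s \near S^'-, f x' < s.
  move=> Kx.
  have [||_ [j Dj <-] gS] := @inf_adherent R [set g j x | j in D] ((S - f x) / 2).
  - by rewrite divr_gt0// subr_gt0 fS.
  - by split=> //; exists (g j0 x); exists j0.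
  set m := _ + _ in gS.
  have mS : m < S.
    rewrite /m -/(f x); have := fS x Kx.
    rewrite -subr_gt0 => d0; rewrite -subr_gt0.
    by rewrite opprD addrA {1}(splitr (S - f x)) addrK divr_gt0.
  exists ([set x' | g j x' < m], [set s | m < s]) => /=.
    split; first exact: (@cvgr_lt _ _ _ _ (g j) _ (gc j x) _ gS).
    exact: nbhs_left_gt.
  move=> [x' s] /= [h1 h2].
  by rewrite (le_lt_trans (fle j x' Dj))// (lt_trans h1).
move=> /(_ _ loc) near_s.
have [s [sS hs]] : exists s, s < S /\ K `<=` (fun x => f x < s).
  have : \forall s \near S^'-, s < S /\ K `<=` (fun x => f x < s).
    by apply: filterI near_s; exact: nbhs_left_lt.
  by move=> /filter_ex.
have : S <= s.
  apply: ge_sup; first by case: K0 => x Kx; exists (f x); exists x.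
  by move=> _ [x Kx <-]; exact/ltW/hs.
by rewrite leNgt sS.
Qed.

Lemma continuous_enorm_mulmx m n (N : 'M[R]_(m, n)) :
  continuous (fun u : 'rV[R]_n => enorm (N *m u^T)).
Proof.
have coord i : continuous (fun u : 'rV[R]_n => (N *m u^T) i ord0).
  rewrite (_ : (fun _ => _) =
      fun w : 'rV[R]_n => \sum_j N i j * w ord0 j); last first.
    by apply/funext => w; rewrite mxE; apply: eq_bigr => j _; rewrite mxE.
  apply: (@continuous_big _ _ +%R 0 xpredT) => [|j _ w]; first exact: add_continuous.
  by apply: continuousM; [exact: cst_continuous|exact: coord_continuous].
have sq : continuous (fun u : 'rV[R]_n => \sum_i (N *m u^T) i ord0 ^+ 2).
  apply: (@continuous_big _ _ +%R 0 xpredT) => [|i _ w]; first exact: add_continuous.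
  apply: (@continuous_comp _ _ _ _ (fun x : R => x ^+ 2)); first exact: coord.
  exact: exprn_continuous.
move=> u; apply: (@continuous_comp _ _ _ _ (@Num.sqrt R)); first exact: sq.
exact: sqrt_continuous.
Qed.

Lemma compact_sphere n : compact [set u : 'rV[R]_n | enorm u^T = 1].
Proof.
apply: bounded_closed_compact.
  exists 1; split=> // r r1 u /= u1; rewrite (le_trans _ (ltW r1))//.
  rewrite [leLHS]mx_normrE; apply/bigmax_leP; split=> //= -[i j] _ /=.
  rewrite ord1 -sqrtr_sqr -u1 ler_sqrt; last first.
    by apply: sumr_ge0 => ? _; exact: sqr_ge0.
  rewrite (bigD1 j)//= mxE lerDl.
  by apply: sumr_ge0 => ? _; exact: sqr_ge0.
rewrite (_ : [set _ | _] = (fun u : 'rV[R]_n => enorm (1%:M *m u^T)) @^-1` [set 1]).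
  by apply: closed_comp => [u _|]; [exact: continuous_enorm_mulmx|exact: closed_eq].
by apply/seteqP; split=> u /=; rewrite mul1mx.
Qed.

Lemma worst_case_gmres_max n k (M : 'M[R]_n.+1) :
  exists2 v : 'cV[R]_n.+1, enorm v = 1 &
    gmres_residual k M v = worst_case_gmres k M /\
    forall w, enorm w = 1 -> gmres_residual k M w <= gmres_residual k M v.
Proof.
have [|||||u /= u1 umax] := @compact_sup_inf_attained 'rV[R]_n.+1 {poly R}
  (residual_poly k) (fun p u => enorm (horner_mx M p *m u^T))
  [set u | enorm u^T = 1].
- exact: compact_sphere.
- exists (delta_mx ord0 ord0); rewrite /= /enorm (bigD1 ord0)//= big1 ?addr0.
    by rewrite !mxE !eqxx expr1n sqrtr1.
  by move=> i i0; rewrite !mxE (negbTE i0) andbF expr0n.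
- by move=> p; exact: continuous_enorm_mulmx.
- by move=> p u; exact: enorm_ge0.
- by exists 1; exact: residual_poly1.
have vmax w : enorm w = 1 -> gmres_residual k M w <= gmres_residual k M u^T.
  by move=> w1; have := umax w^T; rewrite trmxK; exact.
exists u^T => //; split=> //; apply/eqP; rewrite eq_le; apply/andP; split.
  apply: ub_le_sup; last by exists u^T.
  by exists (gmres_residual k M u^T) => _ [w w1 <-]; exact: vmax.
apply: ge_sup; first by exists (gmres_residual k M u^T); exists u^T.
by move=> _ [w w1 <-]; exact: vmax.
Qed.

End Attainment.

(* Main.v *)
Require Import Defs.
From mathcomp Require Import all_boot all_order all_algebra.
From mathcomp Require Import all_classical all_reals all_analysis.
From mathcomp Require Import ring.

(** Both inequalities follow from the cross-equality argument.  Let [v] be a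
    unit worst-case vector for [A], let [p] be its optimal residual polynomial
    and [r = p(A) v], so that the norm of [r] is the worst-case value of [A].
    By optimality [r] is orthogonal to [(q - p)(A) v] for every admissible
    [q] ([min_residual_orthogonal]), hence [<r, q(A) v> = <r, r>].  Move [q(A)]
    to the other side: if [r] is nonzero, the unit vector [c] along [r] satisfies
    [<q(A^T) c, v> = |r|], and by Cauchy-Schwarz [|q(A^T) c| >= |r|], for every
    admissible [q].  So the residual of [A^T] at [c] is at least [|r|], which
    shows that the worst-case value of [A] is at most that of [A^T]
    ([worst_case_gmres_le_trmx]).  Exchanging [A] and [A^T] gives equality. *)

Import Order.TTheory GRing.Theory Num.Theory.

Local Open Scope ring_scope.

Section EuclideanDotProduct.
Context {R : realType} {n : nat}.
Implicit Types u v w : 'cV[R]_n.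

(** The matrix form makes the adjoint rule [dotp_mulmxr] immediate. *)
Definition dotp u v : R := (u^T *m v) ord0 ord0.

Lemma dotpC u v : dotp u v = dotp v u.
Proof. by rewrite /dotp -[v in LHS]trmxK -trmx_mul mxE. Qed.

Lemma dotpDr u v w : dotp u (v + w) = dotp u v + dotp u w.
Proof. by rewrite /dotp mulmxDr mxE. Qed.

Lemma dotpZr a u v : dotp u (a *: v) = a * dotp u v.
Proof. by rewrite /dotp -scalemxAr mxE. Qed.

Lemma dotpDl u v w : dotp (u + v) w = dotp u w + dotp v w.
Proof. by rewrite dotpC dotpDr !(dotpC w). Qed.

Lemma dotpZl a u v : dotp (a *: u) v = a * dotp u v.
Proof. by rewrite dotpC dotpZr (dotpC v). Qed.

Lemma dotp_mulmxr (M : 'M[R]_n) u v : dotp u (M *m v) = dotp (M^T *m u) v.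
Proof. by rewrite /dotp trmx_mul trmxK mulmxA. Qed.

Lemma dotpE u : dotp u u = \sum_(i < n) u i ord0 ^+ 2.
Proof. by rewrite /dotp trmx_mul_self mxE mulr1n. Qed.

Lemma dotp_ge0 u : 0 <= dotp u u.
Proof. by rewrite dotpE sumr_ge0 // => i _; exact: sqr_ge0. Qed.

Lemma dotp_eq0 u : dotp u u = 0 -> u = 0.
Proof.
rewrite dotpE => s0; apply: trmx_mul_self_eq0.
by rewrite trmx_mul_self s0 raddf0.
Qed.

Lemma enormE u : enorm u = Num.sqrt (dotp u u).
Proof. by rewrite dotpE. Qed.

Lemma sqr_enorm u : enorm u ^+ 2 = dotp u u.
Proof. by rewrite enormE sqr_sqrtr // dotp_ge0. Qed.

Lemma enormZ a u : enorm (a *: u) = `|a| * enorm u.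
Proof.
by rewrite !enormE dotpZl dotpZr mulrA -expr2 sqrtrM ?sqr_ge0 // sqrtr_sqr.
Qed.

Lemma cauchy_schwarz_unit u v : enorm v = 1 -> dotp u v <= enorm u.
Proof.
move=> v1; have vv : dotp v v = 1 by rewrite -sqr_enorm v1 expr1n.
(* Positivity at the component of u orthogonal to v. *)
have := dotp_ge0 (u + (- dotp u v) *: v).
rewrite dotpDl !dotpDr !dotpZl !dotpZr vv (dotpC v u).
rewrite [leRHS](_ : _ = dotp u u - dotp u v ^+ 2); last by ring.
rewrite subr_ge0 => h; rewrite enormE (le_trans (ler_norm _)) // -sqrtr_sqr.
by rewrite ler_sqrt ?dotp_ge0.
Qed.

(** First-order optimality of [t = 0] on the line [r + t w]. *)
Lemma line_min_orthogonal r w :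
  (forall t : R, enorm r <= enorm (r + t *: w)) -> dotp r w = 0.
Proof.
move=> rmin.
have [ww0|ww0] := eqVneq (dotp w w) 0.
  by rewrite (dotp_eq0 _ ww0) /dotp mulmx0 mxE.
(* This t minimizes the quadratic t |-> |r + t w|^2. *)
have := rmin (- (dotp r w / dotp w w)).
rewrite !enormE ler_sqrt ?dotp_ge0 //.
rewrite dotpDl !dotpDr !dotpZl !dotpZr (dotpC w r).
set a := dotp r w; set b := dotp w w; set c := dotp r r.
have b0 : 0 < b by rewrite lt_neqAle eq_sym ww0 dotp_ge0.
rewrite [leRHS](_ : _ = c - a ^+ 2 / b); last by field.
rewrite lerDl oppr_ge0 pmulr_lle0 ?invr_gt0 // => a2.
by apply/eqP; rewrite -sqrf_eq0 eq_le a2 sqr_ge0.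
Qed.

End EuclideanDotProduct.

Lemma horner_mx_trmx (F : comNzRingType) (n : nat) (A : 'M[F]_n.+1)
  (p : {poly F}) :
  horner_mx A^T p = (horner_mx A p)^T.
Proof.
elim/poly_ind: p => [|p c IH]; first by rewrite !rmorph0 trmx0.
rewrite !rmorphD !rmorphM /= !horner_mx_X !horner_mx_C IH.
rewrite linearD /= tr_scalar_mx; congr (_ + _).
rewrite -!mulmxE -trmx_mul; congr trmx.
exact: comm_mx_horner.
Qed.

Section WorstCase.
Context {R : realType} {n : nat}.
Context (k : nat) (A : 'M[R]_n.+1).

(** Admissible polynomials form an affine space, so an optimal one may be
    perturbed along the whole line through any other one. *)
Lemma min_residual_orthogonal (v : 'cV[R]_n.+1) (p q : {poly R}) :
  residual_poly k p ->
  (forall s, residual_poly k s ->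
     enorm (horner_mx A p *m v) <= enorm (horner_mx A s *m v)) ->
  residual_poly k q ->
  dotp (horner_mx A p *m v) (horner_mx A (q - p) *m v) = 0.
Proof.
move=> [sp p0] pmin [sq q0]; apply: line_min_orthogonal => t.
have -> : horner_mx A p *m v + t *: (horner_mx A (q - p) *m v) =
          horner_mx A (p + t *: (q - p)) *m v.
  by rewrite [in RHS]rmorphD /= linearZ /= mulmxDl scalemxAl.
apply: pmin; split; last by rewrite !hornerE p0 q0 subrr mulr0 addr0.
rewrite (leq_trans (size_polyD _ _)) // geq_max sp.
rewrite (leq_trans (size_scale_leq _ _)) //.
by rewrite (leq_trans (size_polyD _ _)) // size_polyN geq_max sq.
Qed.

Lemma le_gmres_residual (v : 'cV[R]_n.+1) (a : R) :
  (forall q, residual_poly k q -> a <= enorm (horner_mx A q *m v)) ->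
  a <= gmres_residual k A v.
Proof. by have [q qk [<- _]] := gmres_residual_min k A v; exact. Qed.

Lemma gmres_residual_le_worst_case (v : 'cV[R]_n.+1) :
  enorm v = 1 -> gmres_residual k A v <= worst_case_gmres k A.
Proof. by have [w _ [<- wmax]] := worst_case_gmres_max k A; exact: wmax. Qed.

Lemma worst_case_gmres_ge0 : 0 <= worst_case_gmres k A.
Proof.
have [v _ [<- _]] := worst_case_gmres_max k A.
by apply: le_gmres_residual => q _; exact: enorm_ge0.
Qed.

End WorstCase.

(** The witness for [A^T] is the unit vector along the residual of a worst-case
    vector for [A]; if that residual vanishes, the left-hand side is zero. *)
Lemma worst_case_gmres_le_trmx (R : realType) (n k : nat) (A : 'M[R]_n.+1) :
  worst_case_gmres k A <= worst_case_gmres k A^T.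
Proof.
have [v v1 [<- _]] := worst_case_gmres_max k A.
have [p pk [<- pmin]] := gmres_residual_min k A v.
set r := horner_mx A p *m v.
have [r0|r_neq0] := eqVneq (enorm r) 0.
  by rewrite r0; exact: worst_case_gmres_ge0.
pose c := (enorm r)^-1 *: r.
have c1 : enorm c = 1.
  by rewrite enormZ ger0_norm ?invr_ge0 ?enorm_ge0 // mulVf.
apply: le_trans (gmres_residual_le_worst_case _ _ _ c1).
apply: le_gmres_residual => q qk.
have rq : dotp r (horner_mx A q *m v) = enorm r ^+ 2.
  rewrite -[q](subrK p) rmorphD mulmxDl dotpDr.
  by rewrite (min_residual_orthogonal _ _ _ _ _ pk pmin qk) add0r sqr_enorm.
have <- : dotp (horner_mx A^T q *m c) v = enorm r.
  by rewrite horner_mx_trmx -dotp_mulmxr dotpZl rq expr2 mulKf.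
exact: cauchy_schwarz_unit.
Qed.

Theorem theorem2p1 (R : realType) (n : nat) (A : 'M[R]_n.+1)
    (hA : A \in unitmx) (k : nat) (hk : (1 <= k <= minpoly_degree A - 1)%N) :
  worst_case_gmres k A = worst_case_gmres k A^T.
Proof.
apply/eqP; rewrite eq_le worst_case_gmres_le_trmx.
by rewrite -[X in _ <= worst_case_gmres k X]trmxK worst_case_gmres_le_trmx.
Qed.
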